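(* No finite simple group is $(\ast)$-coverable.
   Context: For a subgroup $H$ of a group $G$ and $g\in G$, $H^g=g^{-1}Hg$. A covering of a finite group $G$ is a set of proper subgroups of $G$ whose set-theoretical union is $G$ and such that no member of the set is contained in another (different) member of the set. A finite group $G$ is called $(\ast)$-coverable if there exist proper subgroups $H,K$ of $G$ such that $\delta=\{H^g,K: g\in G\}$ is a covering of $G$. *)

(* Defs.v *)
From mathcomp Require Import all_boot all_order all_fingroup all_solvable.

Set Implicit Arguments.
Unset Strict Implicit.
Unset Printing Implicit Defensive.

Local Open Scope group_scope.

Definition is_covering (gT : finGroupType) (G : {group gT})
    (D : {set {group gT}}) : Prop :=
  [/\ forall A : {group gT}, A \in D -> A \proper G,
      \bigcup_(A in D) A = G :> {set gT} &
      forall A B : {group gT}, A \in D -> B \in D -> A != B ->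
        ~~ (A \subset B)].

(* The family {H^g, K : g in G}, as a set of subgroups: K is allowed to
   coincide with one of the conjugates H :^ g = g^-1 H g. *)
Definition star_family (gT : finGroupType) (G H K : {group gT}) :
    {set {group gT}} :=
  [set (H :^ g)%G | g in G] :|: [set K].

Definition star_coverable (gT : finGroupType) (G : {group gT}) : Prop :=
  exists H K : {group gT},
    [/\ H \proper G, K \proper G & is_covering G (star_family G H K)].

(* Main.v *)
Require Import Defs.
From mathcomp Require Import all_boot all_order all_fingroup all_solvable.

(* If H and K are proper and G is the union of K and the conjugates of H, the
   elements of G outside every conjugate of H form a conjugation-invariant
   subset of K. By Jordan's theorem this set is nonempty, and it misses 1, so K
   contains a nontrivial normal subgroup of G. *)

Local Open Scope group_scope.

Lemma class_support_proper (gT : finGroupType) (G H : {group gT}) :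
  H \proper G -> class_support H G \proper G.
Proof.
move=> prHG; have sHG := proper_sub prHG.
rewrite properEcard class_support_subG //= (cardsD1 1 (class_support H G)).
rewrite (cardsD1 1 G) group1 (mem_class_support G (group1 H)) !add1n ltnS.
(* Conjugates of H share 1, so at most |G : H| (|H| - 1) < |G| - 1 nontrivial
   elements are covered. *)
have sHN : H \subset 'N_G(H^#) by rewrite subsetI sHG normD1 normG.
(* The left side counts the conjugates of [H^#]; it is bounded since [H] normalises [H^#]. *)
have leI : #|G : 'N_G(H^#)| <= #|G : H| by rewrite dvdn_leq ?indexgS.
have cardH1 : #|H^#| = #|H|.-1 by rewrite [#|H|](cardsD1 1) group1.
have cardG1 : #|G^#| = #|G|.-1 by rewrite [#|G|](cardsD1 1) group1.
have leC : #|cover (H^# :^: G)| <= #|G : H| * #|H|.-1.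
  apply: leq_trans (leq_card_cover _) _.
  rewrite (eq_bigr (fun=> #|H|.-1)) => [|_ /imsetP[x _ ->]].
    by rewrite sum_nat_const card_conjugates leq_mul2r leI orbT.
  by rewrite cardJg.
rewrite class_supportD1 cardG1; apply: leq_ltn_trans leC _.
have ltI : 1 < #|G : H| by rewrite indexg_gt1; case/andP: prHG.
(* The bound equals [#|G| - #|G : H|], and the index exceeds 1. *)
rewrite -(Lagrange sHG) -!subn1 mulnBr muln1 mulnC.
by apply: ltn_sub2l => //; apply: leq_trans ltI _; rewrite leq_pmull.
Qed.

Theorem corollary2p3 (gT : finGroupType) (G : {group gT}) (hG : simple G) :
  ~ star_coverable G.
Proof.
move=> [H [K [prHG prKG [_ covG _]]]].
have [_ simG] := simpleP _ hG.
pose N := G :\: class_support H G.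
have sNK : N \subset K.
  apply/subsetP=> x /setDP[Gx notHx]; move: Gx.
  rewrite -{1}covG => /bigcupP[A /setUP[/imsetP[g Gg ->]|/set1P->] //] Hgx.
  by case/negP: notHx; rewrite class_supportEr; apply/bigcupP; exists g.
have nNG : G \subset 'N(N).
  by rewrite normsD ?normG ?class_support_norm.
(* Any [G]-invariant subset of [K] lies in the core, even if it is not a subgroup. *)
have sNc : N \subset gcore K G by apply: gcore_max.
(* A trivial core would leave only 1 in [N], yet 1 lies in [H]; a core equal to [G] would give
   [K = G]. *)
have [/= core1 | /= coreG] := simG _ (gcore_normal (proper_sub prKG)).
  have /properP[_ [x Gx notHx]] := class_support_proper _ _ _ prHG.
  have /set1P x1 : x \in [1 gT] by rewrite -core1 (subsetP sNc) // inE notHx.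
  by case/negP: notHx; rewrite x1 mem_class_support.
by case/andP: prKG => _ /negP[]; rewrite -{1}coreG gcore_sub.
Qed.
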